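(* Let $X$ be a Polish space, with any compatible metric. Suppose that $X$ does not contain any triod. Then $E_X^{CC}=E_X^A$.
   Context: A continuum is a nonempty compact connected metrizable space (single points are continua); an arc is a homeomorphic copy of $[0,1]$. A continuum $K$ is a triod if there is a subcontinuum $L\subset K$ such that $K\setminus L$ has at least three connected components. For a metric space $X$, the chain continuum-connection relation $E_X^{CC}$ on $X$ is: $x\,E_X^{CC}\,y$ iff for every $\varepsilon>0$ there are $n\in\mathbb{N}$ and continua $K_0,\dots,K_n\subset X$ of diameter $<\varepsilon$ such that $x\in K_0$, $y\in K_n$ and $K_i\cap K_{i+1}\neq\emptyset$ for $0\le i<n$. The arc-connection relation is $x\,E_X^A\,y$ iff $x=y$ or there is an arc in $X$ containing $x$ and $y$. *)

(* Defs.v *)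
From HB Require Import structures.
From mathcomp Require Import all_boot all_order all_algebra.
From mathcomp Require Import all_classical all_reals all_analysis.
Import Order.TTheory GRing.Theory Num.Theory.
Import numFieldNormedType.Exports.

Set Implicit Arguments.
Unset Strict Implicit.
Unset Printing Implicit Defensive.

Local Open Scope classical_set_scope.
Local Open Scope ring_scope.

Definition is_metric (R : realType) (T : Type) (d : T -> T -> R) : Prop :=
  [/\ forall x y, 0 <= d x y,
      forall x y, d x y = 0 <-> x = y,
      forall x y, d x y = d y x &
      forall x y z, d x z <= d x y + d y z].

Definition metric_compatible (R : realType) (T : topologicalType)
    (d : T -> T -> R) : Prop :=
  forall A : set T, open A <->
    (forall x, A x -> exists2 e : R, 0 < e & [set y | d x y < e] `<=` A).

Definition metric_complete (R : realType) (T : Type)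
    (d : T -> T -> R) : Prop :=
  forall u : nat -> T,
    (forall e : R, 0 < e -> exists N : nat,
       forall m n : nat, (N <= m)%N -> (N <= n)%N -> d (u m) (u n) < e) ->
    exists l : T, forall e : R, 0 < e -> exists N : nat,
      forall n : nat, (N <= n)%N -> d (u n) l < e.

Definition separable (T : topologicalType) : Prop :=
  exists2 D : set T, countable D & dense D.

Definition polish (R : realType) (T : topologicalType) : Prop :=
  separable T /\
  exists d : T -> T -> R,
    [/\ is_metric d, metric_compatible d & metric_complete d].

(* Metrizability is automatic for subsets of the metrizable spaces to which
   this is applied. *)
Definition continuum (T : topologicalType) (K : set T) : Prop :=
  [/\ K !=set0, compact K & connected K].

Definition components (T : topologicalType) (A : set T) : set (set T) :=
  [set connected_component A x | x in A].

Definition triod (T : topologicalType) (K : set T) : Prop :=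
  continuum K /\
  exists L : set T,
    [/\ continuum L, L `<=` K & (`I_3 #<= components (K `\` L))%card].

Definition is_arc (R : realType) (T : topologicalType) (A : set T) : Prop :=
  exists (f : R -> T) (g : T -> R),
    [/\ {within `[0, 1], continuous f} /\ {within A, continuous g},
        set_fun `[0, 1] A f,
        set_fun A `[0, 1] g,
        {in `[0, 1]%classic, cancel f g} &
        {in A, cancel g f}].

Definition diam (R : realType) (X : metricType R) (A : set X) : \bar R :=
  ereal_sup [set (mdist p.1 p.2)%:E | p in A `*` A].

(* Only K 0, ..., K n are constrained. *)
Definition chain_continuum_connected (R : realType) (X : metricType R)
    (x y : X) : Prop :=
  forall e : R, 0 < e ->
    exists (n : nat) (K : nat -> set X),
      [/\ forall i, (i <= n)%N -> continuum (K i) /\ (diam (K i) < e%:E)%E,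
          K 0%N x,
          K n y &
          forall i, (i < n)%N -> K i `&` K i.+1 !=set0].

Definition arc_connected (R : realType) (T : topologicalType)
    (x y : T) : Prop :=
  x = y \/ exists A : set T, [/\ is_arc R A, A x & A y].

(* Main.v *)
(* Take chains from [x] to [y] of minimal length, so that only consecutive
   links meet. In a space without triods a continuum that meets such a chain
   and avoids both of its end links stays inside the chain: otherwise the links
   it meets form the core of a triod whose arms are the two neighbouring links
   and the continuum itself. Hence of two chains, the second being fine, the
   middle part of the first is either contained in the second or disjoint from
   it; and three chains cannot have disjoint middle parts, as these would be
   the arms of a triod with a core near [x]. This yields arbitrarily fine chains
   each containing the middle parts of all the others, and their unions
   intersect in a continuum [I] that is irreducible between [x] and [y] and is
   covered by chains of arbitrarily small subcontinua of [I]. The subcontinua of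
   [I] containing [x] are then linearly ordered by inclusion, and sending [p] to
   a Whitney-type size of the intersection of those that contain [p] is a
   continuous injection of [I] into the real line. *)
Require Import Defs.
From HB Require Import structures.
From mathcomp Require Import all_boot all_order all_algebra.
From mathcomp Require Import all_classical all_reals all_analysis.
From mathcomp Require Import zify ring lra.
Import Order.TTheory GRing.Theory Num.Theory.
Import numFieldNormedType.Exports.
Local Open Scope classical_set_scope.
Local Open Scope ring_scope.

Set Implicit Arguments.
Unset Strict Implicit.
Unset Printing Implicit Defensive.

(** * Continua, and a criterion for triods *)

Section continua.
Context {T : topologicalType}.
Implicit Types A B C K L M : set T.

(** On [A] the set [F] is the complement of [G], so the trace of [F] on [A] is clopen in [A]. *)
Lemma connected_closed_cover A F G : connected A -> closed F -> closed G ->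
  A `<=` F `|` G -> A `&` F `&` G = set0 -> A `&` F !=set0 -> A `<=` F.
Proof.
move=> cA cF cG AFG FG0 AF0.
have <- : A `&` F = A.
  apply: cA => //; last by exists F.
  exists (~` G); first exact: closed_openC.
  apply/seteqP; split=> z [Az].
    by move=> Fz; split=> // Gz; have : set0 z by rewrite -FG0.
  by move=> nGz; split=> //; case: (AFG _ Az).
by move=> z [].
Qed.

Lemma continuumU A B : continuum A -> continuum B -> A `&` B !=set0 ->
  continuum (A `|` B).
Proof.
move=> [[a Aa] kA cA] [_ kB cB] AB; split; first by exists a; left.
  exact: compactU.
exact: connectedU.
Qed.

Lemma hausdorff_continuum_closed A : hausdorff_space T -> continuum A -> closed A.
Proof. by move=> hT [_ kA _]; exact: compact_closed. Qed.

(** Outside [L], the component of a point of one arm stays in that arm, since the other two arms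
    form a closed set disjoint from it. Points of the three arms outside [L] thus lie in three
    different components. *)
Lemma triod_of_arms L A B C : hausdorff_space T ->
  continuum L -> continuum A -> continuum B -> continuum C ->
  A `&` L !=set0 -> B `&` L !=set0 -> C `&` L !=set0 ->
  ~ A `<=` L -> ~ B `<=` L -> ~ C `<=` L ->
  A `&` B = set0 -> A `&` C = set0 -> B `&` C = set0 ->
  triod (L `|` A `|` B `|` C).
Proof.
move=> hT cL cA cB cC AL BL CL nAL nBL nCL AB AC BC.
have cK : continuum (L `|` A `|` B `|` C).
  apply: continuumU => //; last first.
    by case: CL => z [Cz Lz]; exists z; split=> //; left; left.
  apply: continuumU => //; last first.
    by case: BL => z [Bz Lz]; exists z; split=> //; left.
  by apply: continuumU => //; rewrite setIC.
split=> //; exists L; split=> //; first by move=> z Lz; left; left; left.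
set U := _ `\` L.
have arm (D : set T) : D `<=` L `|` A `|` B `|` C -> ~ D `<=` L -> exists z, U z /\ D z.
  move=> DK /existsNP[z /not_implyP[Dz nLz]]; exists z; split=> //; split=> //.
  exact: DK.
have [a [Ua Aa]] : exists z, U z /\ A z by apply: arm => // z; left; left; right.
have [b [Ub Bb]] : exists z, U z /\ B z by apply: arm => // z; left; right.
have [c [Uc Cc]] : exists z, U z /\ C z by apply: arm => // z; right.
have clo D := @hausdorff_continuum_closed D hT.
have sep (D E F : set T) (d : T) : continuum D -> continuum E -> continuum F ->
    D `&` E = set0 -> D `&` F = set0 -> U `<=` D `|` (E `|` F) -> U d -> D d ->
    connected_component U d `<=` D.
  move=> cD cE cF DE DF UD Ud Dd.
  apply: (@connected_closed_cover _ D (E `|` F)).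
  - exact: component_connected.
  - exact: clo.
  - by apply: closedU; exact: clo.
  - exact: subset_trans (@connected_component_sub _ _ _) UD.
  - by rewrite -setIA setIUr DE DF setU0 setI0.
  - by exists d; split=> //; exact: connected_component_refl.
have ne (D E : set T) d e : connected_component U d `<=` D -> U e ->
    E e -> D `&` E = set0 -> connected_component U d <> connected_component U e.
  move=> UD Ue Ee DE /seteqP[_ /(_ e)] /(_ (connected_component_refl Ue)) /UD De.
  by have : set0 e by rewrite -DE.
have Ucov z : U z -> [\/ A z, B z | C z].
  by move=> [[[[Lz|Az]|Bz]|Cz] nLz] //;
    [apply: Or31|apply: Or32|apply: Or33].
have sa : connected_component U a `<=` A.
  apply: (@sep A B C) => // z /Ucov[]; first by left.
    by right; left.
  by right; right.
have sb : connected_component U b `<=` B.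
  apply: (@sep B A C) => //; first by rewrite setIC.
  move=> z /Ucov[]; [by right; left|by left|by right; right].
have nab := ne _ _ _ _ sa Ub Bb AB.
have nac := ne _ _ _ _ sa Uc Cc AC.
have nbc := ne _ _ _ _ sb Uc Cc BC.
pose f i := connected_component U (if i is 0 then a else if i is 1 then b else c)%N.
have fI : {in `I_3 &, injective f}.
  by move=> [|[|[|i]]] [|[|[|j]]]; rewrite !inE //= => _ _;
    rewrite /f => E; exfalso; auto.
apply: card_le_trans (_ : (`I_3 #<= f @` `I_3)%card) _.
  have /card_eqPle[_ //] := inj_card_eq fI.
apply: subset_card_le => _ [i _ <-]; rewrite /components /=.
by case: i => [|[|i]]; [exists a|exists b|exists c].
Qed.

End continua.

(** * Chains of continua *)

Definition links (T : Type) (K : nat -> set T) (a b : nat) : set T :=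
  [set z | exists2 i, (a <= i <= b)%N & K i z].

Record chain (T : topologicalType) (x y : T) (n : nat) (K : nat -> set T) :
    Prop := Chain {
  chain_continuum : forall i, (i <= n)%N -> continuum (K i) ;
  chain_start : K 0%N x ;
  chain_end : K n y ;
  chain_meet : forall i, (i < n)%N -> K i `&` K i.+1 !=set0 }.

Record linear_chain (T : topologicalType) (x y : T) (n : nat)
    (K : nat -> set T) : Prop := LinearChain {
  linear_is_chain :> chain x y n K ;
  linear_disjoint : forall i j, (i.+1 < j <= n)%N -> K i `&` K j = set0 ;
  linear_start : forall i, (0 < i <= n)%N -> ~ K i x ;
  linear_end : forall i, (i < n)%N -> ~ K i y }.

Section chains.
Context {T : topologicalType}.
Implicit Types (x y z : T) (K : nat -> set T) (M : set T).

Lemma linear_sep x y n K i j z : linear_chain x y n K ->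
  (i.+1 < j <= n)%N -> K i z -> ~ K j z.
Proof.
move=> cK ij Kiz Kjz.
by have : set0 z by rewrite -(linear_disjoint cK ij).
Qed.

Lemma links_continuum x y n K a b : chain x y n K -> (a <= b <= n)%N ->
  continuum (links K a b).
Proof.
move=> cK; elim: b => [|b IHb] /andP[ab bn].
  have -> : a = 0%N by lia.
  rewrite (_ : links K 0 0 = K 0%N); first exact: (chain_continuum cK).
  apply/seteqP; split=> z; first by move=> [i i0 Kiz]; have -> : 0%N = i by lia.
  by move=> K0z; exists 0%N.
have [ab'|ab'] := leqP a b; last first.
  have -> : a = b.+1 by lia.
  rewrite (_ : links K b.+1 b.+1 = K b.+1); first exact: (chain_continuum cK).
  apply/seteqP; split=> z; first by move=> [i ib Kiz]; have -> : b.+1 = i by lia.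
  by move=> K0z; exists b.+1; [lia|].
rewrite (_ : links K a b.+1 = links K a b `|` K b.+1); last first.
  apply/seteqP; split=> z.
    move=> [i /andP[ai]]; rewrite leq_eqVlt => /orP[/eqP->|ib] Kiz; first by right.
    by left; exists i => //; rewrite ai.
  by move=> [[i /andP[ai ib] Kiz]|Kz]; [exists i => //; lia|exists b.+1 => //; lia].
apply: continuumU; first by apply: IHb; lia.
  by apply: (chain_continuum cK); lia.
have [z [Kbz Kbz']] : K b `&` K b.+1 !=set0 by apply: (chain_meet cK); lia.
by exists z; split=> //; exists b => //; lia.
Qed.

(** [K a] holds a point that no later link has: [x] if [a] is 0, otherwise a common point with the
    preceding link. This and its mirror image below keep arms from lying inside cores. *)
Lemma linear_nsubl x y n K a b : linear_chain x y n K -> (a < n)%N -> (b <= n)%N ->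
  ~ K a `<=` links K a.+1 b.
Proof.
move=> cK an bn Kab; case: a an Kab => [|a] an Kab.
  have [i i0 Kix] := Kab _ (chain_start cK).
  by apply: (linear_start cK) Kix; lia.
have [z [Kaz Ka1z]] : K a `&` K a.+1 !=set0 by apply: (chain_meet cK); lia.
have [i ia Kiz] := Kab _ Ka1z.
by apply: (linear_sep cK _ Kaz Kiz); lia.
Qed.

Lemma linear_nsubr x y n K a b : linear_chain x y n K -> (b < n)%N ->
  ~ K b.+1 `<=` links K a b.
Proof.
move=> cK bn Kab.
have [bn'|bn'] := eqVneq b.+1 n.
  have [|i ib Kiy] := Kab y; first by rewrite bn'; exact: (chain_end cK).
  by apply: (linear_end cK) Kiy; lia.
have [z [Kaz Ka1z]] : K b.+1 `&` K b.+2 !=set0 by apply: (chain_meet cK); lia.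
have [i ia Kiz] := Kab _ Kaz.
by apply: (linear_sep cK _ Kiz Ka1z); lia.
Qed.

Lemma linear_chain_rev x y n K : linear_chain x y n K ->
  linear_chain y x n (fun i => K (n - i)%N).
Proof.
move=> cK; split; first split.
- by move=> i ni; apply: (chain_continuum cK); lia.
- by rewrite subn0; exact: (chain_end cK).
- by rewrite subnn; exact: (chain_start cK).
- move=> i ni; rewrite setIC.
  have := chain_meet cK (_ : n - i.+1 < n)%N.
  have -> : (n - i.+1).+1 = (n - i)%N by lia.
  by apply; lia.
- by move=> i j ij; rewrite setIC; apply: (linear_disjoint cK); lia.
- by move=> i ni; apply: (linear_end cK); lia.
- by move=> i ni; apply: (linear_start cK); lia.
Qed.

(* A chain of minimal length has no shortcuts. *)
Lemma exists_linear_chain (Q : set T -> Prop) x y n K : chain x y n K ->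
  (forall i, (i <= n)%N -> Q (K i)) ->
  exists m H, linear_chain x y m H /\ forall i, (i <= m)%N -> Q (H i).
Proof.
move=> cK QK.
pose P m := `[< exists H, chain x y m H /\ forall i, (i <= m)%N -> Q (H i) >].
have exP : exists m, P m by exists n; apply/asboolP; exists K.
case: (ex_minnP exP) => m /asboolP[H [cH QH]] minm.
exists m, H; split=> //; split=> //.
- move=> i j ij; apply/seteqP; split=> z // [Hiz Hjz]; exfalso.
  suff : (m <= m - (j - i.+1))%N by lia.
  apply: minm; apply/asboolP.
  (* [s] jumps from [i] to [j]; the shortened sequence is still a chain because [z] lies in both
     links. *)
  pose s k := if (k <= i)%N then k else (k + (j - i.+1))%N.
  exists (H \o s); split; first split.
  + by move=> k km; apply: (chain_continuum cH); rewrite /s; case: ifP; lia.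
  + exact: (chain_start cH).
  + rewrite /= /s; case: ifP; first by lia.
    by move=> _; rewrite subnK; [exact: (chain_end cH)|lia].
  + move=> k km; rewrite /= /s; have [ki|ik] := leqP k i.
      have [ki'|ik'] := leqP k.+1 i; first by apply: (chain_meet cH); lia.
      have -> : k = i by lia.
      have -> : (i.+1 + (j - i.+1))%N = j by lia.
      by exists z.
    have -> : (k.+1 <= i)%N = false by lia.
    by rewrite addSn; apply: (chain_meet cH); lia.
  + by move=> k km; apply: QH; rewrite /s; case: ifP; lia.
(* A later link containing [x] could start the chain; in the next case, an earlier link containing
   [y] could end it. *)
- move=> i im Hix; suff : (m <= m - i)%N by lia.
  apply: minm; apply/asboolP; exists (fun k => H (k + i)%N).
  split; last by move=> k km; apply: QH; lia.
  split=> //.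
  + by move=> k km; apply: (chain_continuum cH); lia.
  + by rewrite subnK; [exact: (chain_end cH)|lia].
  + by move=> k km; rewrite addSn; apply: (chain_meet cH); lia.
- move=> i im Hiy; suff : (m <= i)%N by lia.
  apply: minm; apply/asboolP; exists H.
  split; last by move=> k km; apply: QH; lia.
  split=> //.
  + by move=> k km; apply: (chain_continuum cH); lia.
  + exact: (chain_start cH).
  + by move=> k km; apply: (chain_meet cH); lia.
Qed.

Hypothesis hT : hausdorff_space T.
Hypothesis no_triod : forall K : set T, ~ triod K.

(** Let [lo] and [hi] be the first and last indices of links met by [M]. As [M] avoids the end
    links, there are links just before [lo] and just after [hi], both missing [M]. If some point of
    [M] were in no link, these two links and [M] would be arms on the core from [lo] to [hi]. *)
Lemma continuum_sub_links x y n K M : linear_chain x y n K -> continuum M ->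
  M `&` K 0%N = set0 -> M `&` K n = set0 -> M `&` links K 0 n !=set0 ->
  M `<=` links K 0 n.
Proof.
move=> cK cM M0 Mn [z0 [Mz0 [i0 i0n Kz0]]].
pose P i := (i <= n)%N && `[< M `&` K i !=set0 >].
have exP : exists i, P i.
  by exists i0; apply/andP; split=> //; apply/asboolP; exists z0.
have Pn i : P i -> (i <= n)%N by case/andP.
case: (ex_minnP exP) => lo /andP[lon /asboolP Mlo] minlo.
case: (ex_maxnP exP Pn) => hi /andP[hin /asboolP Mhi] maxhi.
have lohi : (lo <= hi)%N by apply: minlo; rewrite /P hin; apply/asboolP.
have lo0 : (0 < lo)%N.
  rewrite lt0n; apply/eqP => lo0; move: Mlo; rewrite lo0 M0.
  by case.
have hin' : (hi < n)%N.
  rewrite ltn_neqAle hin andbT; apply/eqP => e; move: Mhi; rewrite e Mn.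
  by case.
have miss i : (i <= n)%N -> ~ P i -> M `&` K i = set0.
  move=> ni /negP; rewrite /P ni /= => /asboolPn; apply: contra_notP.
  by move=> /eqP/set0P.
move=> z Mz; apply: contrapT => nz.
apply: (no_triod (@triod_of_arms _ (links K lo hi) (K lo.-1) (K hi.+1) M
  _ _ _ _ _ _ _ _ _ _ _ _ _ _)) => //.
- by apply: (links_continuum cK); lia.
- by apply: (chain_continuum cK); lia.
- by apply: (chain_continuum cK); lia.
- have [u [u1 u2]] : K lo.-1 `&` K lo.-1.+1 !=set0 by apply: (chain_meet cK); lia.
  exists u; split=> //; exists lo; first by rewrite leqnn.
  by rewrite -(prednK lo0).
- have [u [u1 u2]] : K hi `&` K hi.+1 !=set0 by apply: (chain_meet cK); lia.
  by exists u; split=> //; exists hi => //; rewrite leqnn lohi.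
- case: Mlo => u [Mu Ku]; exists u; split=> //; exists lo => //.
  by rewrite leqnn.
- by rewrite -{2}(prednK lo0); apply: (linear_nsubl cK); lia.
- by apply: (linear_nsubr cK); lia.
- move=> /(_ _ Mz) [i ilh Kiz]; apply: nz; exists i => //; lia.
- by apply: (linear_disjoint cK); lia.
- rewrite setIC; apply: miss; first by lia.
  by move/minlo; lia.
- by rewrite setIC; apply: miss => // /maxhi; lia.
Qed.

(* Between a skipped link [K j] and the last link met by [M], the links form the
   core of a triod with arms [K j], the next link and [M]. *)
Lemma continuum_meets_between x y n K M i j h : linear_chain x y n K ->
  continuum M -> M `&` K n = set0 -> (i <= j <= h)%N -> (h <= n)%N ->
  M `&` K i !=set0 -> M `&` K h !=set0 -> M `&` K j !=set0.
Proof.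
move=> cK cM Mn ijh hn Mi Mh; apply: contrapT => nMj.
pose P i := (i <= n)%N && `[< M `&` K i !=set0 >].
have Ph : P h by rewrite /P hn; apply/asboolP.
have Pn k : P k -> (k <= n)%N by case/andP.
case: (ex_maxnP (ex_intro _ h Ph) Pn) => hi /andP[hin /asboolP Mhi] maxhi.
have hhi : (h <= hi)%N by exact: maxhi.
have hin' : (hi < n)%N.
  rewrite ltn_neqAle hin andbT; apply/eqP => e; move: Mhi; rewrite e Mn.
  by case.
pose Q k := (k <= hi)%N && ~~ P k.
have nPj : ~~ P j by rewrite /P negb_and; apply/orP; right; apply/asboolPn.
have Qj : Q j by rewrite /Q nPj andbT; lia.
have Qn k : Q k -> (k <= hi)%N by case/andP.
(* [g] is the last index before [hi] whose link misses [M]; [K g] serves as the arm in place of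
   [K j]. *)
case: (ex_maxnP (ex_intro _ j Qj) Qn) => g /andP[ghi nPg] maxg.
have jg : (j <= g)%N by exact: maxg.
have Phi : P hi by rewrite /P hin; apply/asboolP.
have ghi' : (g < hi)%N.
  by rewrite ltn_neqAle ghi andbT; apply: contraNneq nPg => ->.
have Pi : P i by rewrite /P; apply/andP; split; [lia|apply/asboolP].
have ig : (i < g)%N.
  rewrite ltn_neqAle; apply/andP; split; last by lia.
  by apply: contraNneq nPg => <-.
have miss k : (k <= n)%N -> ~~ P k -> M `&` K k = set0.
  move=> nk; rewrite /P nk /= => /asboolPn; apply: contra_notP.
  by move=> /eqP/set0P.
apply: (no_triod (@triod_of_arms _ (links K g.+1 hi) (K g) (K hi.+1) M
  _ _ _ _ _ _ _ _ _ _ _ _ _ _)) => //.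
- by apply: (links_continuum cK); lia.
- by apply: (chain_continuum cK); lia.
- by apply: (chain_continuum cK); lia.
- have [u [u1 u2]] : K g `&` K g.+1 !=set0 by apply: (chain_meet cK); lia.
  by exists u; split=> //; exists g.+1 => //; lia.
- have [u [u1 u2]] : K hi `&` K hi.+1 !=set0 by apply: (chain_meet cK); lia.
  by exists u; split=> //; exists hi => //; lia.
- case: Mhi => u [Mu Ku]; exists u; split=> //; exists hi => //; lia.
- by apply: (linear_nsubl cK); lia.
- by apply: (linear_nsubr cK); lia.
(* [M] leaves the core: it meets [K i], and [i < g] makes [K i] disjoint from every core link. *)
- case: Mi => u [Mu Ku] /(_ _ Mu) [k kg Kku].
  by apply: (linear_sep cK _ Ku Kku); lia.
- by apply: (linear_disjoint cK); lia.
- by rewrite setIC; apply: miss => //; lia.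
- by rewrite setIC; apply: miss => //; apply/negP => /maxhi; lia.
Qed.

End chains.

(** * Comparing chains *)

(** A pairwise bound that avoids extended reals. It only gives diameter at most [e], so passing back
    to a strict bound on the diameter costs a slightly larger constant. *)
Definition small (R : realType) (X : metricType R) (e : R) (A : set X) : Prop :=
  forall a b, A a -> A b -> mdist a b < e.

(** The chain without its end links; empty unless [2 <= n]. *)
Definition mid (T : Type) (K : nat -> set T) (n : nat) : set T :=
  links K 1 n.-1.

(* The end links of [H] are small enough to meet, among the links of [K],
   only the corresponding end link. *)
Definition finer (T : Type) (n : nat) (K : nat -> set T) (m : nat)
    (H : nat -> set T) : Prop :=
  H 0%N `&` links K 1 n = set0 /\ H m `&` links K 0 n.-1 = set0.

Section metric.
Context {R : realType} {X : metricType R}.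
Implicit Types (A B M : set X) (e : R).

Lemma small_diam e A : (diam A < e%:E)%E -> small e A.
Proof.
move=> Ae a b Aa Ab; rewrite -lte_fin; apply: le_lt_trans Ae.
by apply: ereal_sup_ubound; exists (a, b).
Qed.

Lemma diam_small e e' A : e < e' -> small e A -> (diam A < e'%:E)%E.
Proof.
move=> ee' Ae; apply: (@le_lt_trans _ _ e%:E); last by rewrite lte_fin.
by apply: ge_ereal_sup => _ [[a b] [/= Aa Ab] <-]; rewrite lee_fin ltW //; exact: Ae.
Qed.

Lemma closed_ball_disjoint A z : closed A -> ~ A z ->
  exists2 e, 0 < e & forall a, A a -> e <= mdist z a.
Proof.
move=> cA nAz; have : nbhs z (~` A).
  by apply: open_nbhs_nbhs; split=> //; exact: closed_openC.
move=> /nbhs_ballP[e e0 eA]; exists e => // a Aa.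
by rewrite leNgt; apply/negP => ze; apply: (eA a) => //; rewrite ballEmdist.
Qed.

Lemma closed_approx A z : closed A ->
  (forall e, 0 < e -> exists2 a, A a & mdist z a < e) -> A z.
Proof.
move=> cA zA; apply: contrapT => /(closed_ball_disjoint cA)[e e0 eA].
have [a Aa] := zA _ e0.
by rewrite ltNge eA.
Qed.

Lemma closure_approx A z :
  (forall e, 0 < e -> exists2 a, A a & mdist z a < e) -> closure A z.
Proof.
move=> zA; apply: closed_approx; first exact: closed_closure.
move=> e /zA[a Aa ae]; exists a => //; exact: subset_closure.
Qed.

Lemma continuum_closed A : continuum A -> closed A.
Proof. by apply: hausdorff_continuum_closed; exact: metric_hausdorff. Qed.

End metric.

(** * Fine chains in a space without triods *)

Section refinement.
Context {R : realType} {X : metricType R}.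
Implicit Types (A B M : set X) (e : R) (K H G : nat -> set X).
Hypothesis no_triod : forall K : set X, ~ triod K.
Variables x y : X.

Let hX : hausdorff_space X := @metric_hausdorff R X.

(** [x] has positive distance from the closed union of all links but the first, and [y] from that of
    all links but the last. End links of size below both distances avoid these unions. *)
Lemma exists_finer n K : linear_chain x y n K -> (0 < n)%N ->
  exists2 e, 0 < e & forall m H, linear_chain x y m H ->
    (forall i, (i <= m)%N -> small e (H i)) -> finer n K m H.
Proof.
move=> cK n0.
have cl a b : (a <= b <= n)%N -> closed (links K a b).
  by move=> abn; apply: continuum_closed; exact: (links_continuum cK).
have nx : ~ links K 1 n x.
  by move=> [i ir Kix]; apply: (linear_start cK) Kix; lia.
have ny : ~ links K 0 n.-1 y.
  by move=> [i ir Kix]; apply: (linear_end cK) Kix; lia.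
have [|e1 e10 xe1] := closed_ball_disjoint (cl 1%N n _) nx; first by lia.
have [|e2 e20 xe2] := closed_ball_disjoint (cl 0%N n.-1 _) ny; first by lia.
exists (Num.min e1 e2); first by rewrite lt_min e10.
move=> m H cH smallH; split; apply/seteqP; split=> z // [Hz Kz].
  have := smallH _ (leq0n m) _ _ (chain_start cH) Hz.
  by rewrite lt_min ltNge xe1.
have := smallH _ (leqnn m) _ _ (chain_end cH) Hz.
by rewrite lt_min andbC ltNge xe2.
Qed.

Lemma mid_continuum n K : linear_chain x y n K -> (2 <= n)%N ->
  continuum (mid K n).
Proof. by move=> cK n2; apply: (links_continuum cK); lia. Qed.

Lemma finer_mid_start n K m H : finer n K m H -> mid K n `&` H 0%N = set0.
Proof.
move=> [H0 _]; apply/seteqP; split=> z // [[i ir Kz] Hz].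
by rewrite -H0; split=> //; exists i => //; lia.
Qed.

Lemma finer_mid_end n K m H : finer n K m H -> mid K n `&` H m = set0.
Proof.
move=> [_ H0]; apply/seteqP; split=> z // [[i ir Kz] Hz].
by rewrite -H0; split=> //; exists i => //; lia.
Qed.

Lemma mid_sub_links n K m H : linear_chain x y n K -> (2 <= n)%N ->
  linear_chain x y m H -> finer n K m H -> mid K n `&` links H 0 m !=set0 ->
  mid K n `<=` links H 0 m.
Proof.
move=> cK n2 cH f; apply: (continuum_sub_links hX no_triod cH).
- exact: mid_continuum.
- exact: finer_mid_start f.
- exact: finer_mid_end f.
Qed.

(** A common point [w] of the first two links of [K] lies in some [H a]. For [j <= a], the union of
    all links of [K] but the last joins [H 0] (at [x]) to [H a] (at [w]) and avoids [H m], so it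
    cannot skip [H j]. For larger [j] the same is applied to the reversed chain, with the union of
    all links but the first. *)
Lemma finer_meets_links n K m H j : linear_chain x y n K -> (2 <= n)%N ->
  linear_chain x y m H -> finer n K m H -> mid K n `<=` links H 0 m ->
  (j <= m)%N -> H j `&` links K 0 n !=set0.
Proof.
move=> cK n2 cH [fx fy] KH jm.
have [w [K0w K1w]] : K 0%N `&` K 1%N !=set0 by apply: (chain_meet cK); lia.
have [|a am Haw] := KH w; first by exists 1%N => //; lia.
have [ja|aj] := leqP j a.
  have [||||||z [[i ir Kz] Hz]] :=
    @continuum_meets_between _ hX no_triod _ _ _ _ (links K 0 n.-1) 0 j a cH.
  - by apply: (links_continuum cK); lia.
  - by rewrite setIC.
  - by lia.
  - by lia.
  - exists x; split; last exact: (chain_start cH).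
    by exists 0%N => //; exact: (chain_start cK).
  - by exists w; split=> //; exists 1%N => //; lia.
  - by exists z; split=> //; exists i => //; lia.
have [||||||z [[i ir Kz] Hz]] :=
    @continuum_meets_between _ hX no_triod _ _ _ _ (links K 1 n) 0 (m - j) (m - a) (linear_chain_rev cH).
- by apply: (links_continuum cK); lia.
- by rewrite setIC subnn.
- by lia.
- by lia.
- exists y; rewrite subn0; split; last exact: (chain_end cH).
  by exists n; [lia|exact: (chain_end cK)].
- by exists w; rewrite subKn; [split=> //; exists 1%N => //; lia|lia].
- move: Hz; rewrite subKn // => Hz.
  by exists z; split=> //; exists i => //; lia.
Qed.

(** One or two links of size below half the distance cannot reach from [x] to [y]. *)
Lemma small_linear_chain_size e n K : e <= mdist x y / 2 ->
  linear_chain x y n K -> (forall i, (i <= n)%N -> small e (K i)) -> (2 <= n)%N.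
Proof.
move=> exy cK sK; have cx := chain_start cK; have cy := chain_end cK.
have xy0 := mdist_ge0 x y.
case: n cK sK cy => [|[|n]] // cK sK cy.
  have := sK 0%N isT _ _ cx cy; lra.
have [w [K0w K1w]] : K 0%N `&` K 1%N !=set0 by apply: (chain_meet cK); lia.
have := sK 0%N isT _ _ cx K0w; have := sK 1%N isT _ _ K1w cy.
have := metric_triangle x w y; lra.
Qed.

(** The core is the union of the three first links, which share [x]. Each middle part meets it, and
    leaves it at a point of the last link: that point is within [e] of [y], the core is within [e]
    of [x], and [y] is at least [2 e] away from [x]. *)
Lemma three_mids e n K m H l G : e <= mdist x y / 2 ->
  linear_chain x y n K -> (forall i, (i <= n)%N -> small e (K i)) ->
  linear_chain x y m H -> (forall i, (i <= m)%N -> small e (H i)) ->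
  linear_chain x y l G -> (forall i, (i <= l)%N -> small e (G i)) ->
  mid K n `&` mid H m = set0 -> mid K n `&` mid G l = set0 ->
  mid H m `&` mid G l = set0 -> False.
Proof.
move=> exy cK sK cH sH cG sG KH KG HG.
have nearx z : (K 0%N `|` H 0%N `|` G 0%N) z -> mdist x z < e.
  move=> [[|]|].
  - exact: (sK _ (leq0n n) _ _ (chain_start cK)).
  - exact: (sH _ (leq0n m) _ _ (chain_start cH)).
  - exact: (sG _ (leq0n l) _ _ (chain_start cG)).
have arm k J : linear_chain x y k J -> (forall i, (i <= k)%N -> small e (J i)) ->
    [/\ continuum (J 0%N), continuum (mid J k), mid J k `&` J 0%N !=set0 &
      ~ mid J k `<=` K 0%N `|` H 0%N `|` G 0%N].
  move=> cJ sJ; have k2 := small_linear_chain_size exy cJ sJ.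
  split.
  - exact: (chain_continuum cJ).
  - exact: mid_continuum.
  - have [w [w0 w1]] : J 0%N `&` J 1%N !=set0 by apply: (chain_meet cJ); lia.
    by exists w; split=> //; exists 1%N => //; lia.
  - have [w [w0 w1]] : J k.-1 `&` J k.-1.+1 !=set0 by apply: (chain_meet cJ); lia.
    move=> /(_ w) []; first by exists k.-1 => //; lia.
      move=> h; have := nearx w (or_introl h).
      rewrite prednK in w1; last by lia.
      have := sJ _ (leqnn k) _ _ w1 (chain_end cJ).
      have := metric_triangle x w y; lra.
    move=> h; have := nearx w (or_intror h).
    rewrite prednK in w1; last by lia.
    have := sJ _ (leqnn k) _ _ w1 (chain_end cJ).
    have := metric_triangle x w y; lra.
have [K0 mK [u [u1 u2]] nK] := arm _ _ cK sK.
have [H0 mH [v [v1 v2]] nH] := arm _ _ cH sH.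
have [G0 mG [w [w1 w2]] nG] := arm _ _ cG sG.
have cL : continuum (K 0%N `|` H 0%N `|` G 0%N).
  apply: continuumU => //.
    apply: continuumU => //.
    by exists x; split; [exact: (chain_start cK)|exact: (chain_start cH)].
  exists x; split; last exact: (chain_start cG).
  by left; exact: (chain_start cK).
apply: (no_triod (@triod_of_arms _ _ (mid K n) (mid H m) (mid G l)
  hX cL mK mH mG _ _ _ nK nH nG KH KG HG)).
- by exists u; split=> //; left; left.
- by exists v; split=> //; left; right.
- by exists w; split=> //; right.
Qed.

Hypothesis xy : x <> y.
Hypothesis small_chains : forall e, 0 < e ->
  exists n K, linear_chain x y n K /\ forall i, (i <= n)%N -> small e (K i).

Let dxy : 0 < mdist x y / 2.
Proof. by rewrite divr_gt0 // mdist_gt0; exact/eqP. Qed.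

Lemma small_le e e' A : e <= e' -> small e A -> small e' A.
Proof. by move=> ee' sA a b Aa Ab; apply: lt_le_trans ee'; exact: sA. Qed.

(* If finer chains eventually missed the middle part of every chain, three
   successively finer chains would have disjoint middle parts. *)
Lemma exists_persistent_chain : exists n K,
  [/\ linear_chain x y n K, (2 <= n)%N &
  forall e, 0 < e -> exists m H, [/\ linear_chain x y m H, (2 <= m)%N,
    forall i, (i <= m)%N -> small e (H i), finer n K m H &
    mid K n `<=` links H 0 m]].
Proof.
apply: contrapT => noP.
(* A finer chain whose middle part met [mid K n] would contain [mid K n] in its links. If [K] is not
   persistent, all sufficiently fine chains therefore have a disjoint middle part. *)
have step n K : linear_chain x y n K -> (2 <= n)%N -> exists2 e, 0 < e &
    forall m H, linear_chain x y m H -> (2 <= m)%N ->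
      (forall i, (i <= m)%N -> small e (H i)) -> mid K n `&` mid H m = set0.
  move=> cK n2; apply: contrapT => noe; apply: noP.
  exists n, K; split=> // e e0.
  have [f f0 fK] := exists_finer cK (ltnW n2).
  apply: contrapT => noH; apply: noe.
  exists (Num.min e f); first by rewrite lt_min e0.
  move=> m H cH m2 sH.
  have fH : finer n K m H.
    apply: fK => // i im; apply: small_le (sH _ im).
    by rewrite ge_min lexx orbT.
  apply: contrapT => /eqP/set0P[z [Kz [i ir Hz]]]; apply: noH.
  exists m, H; split=> //.
    move=> j jm; apply: small_le (sH _ jm).
    by rewrite ge_min lexx.
  apply: mid_sub_links => //; exists z; split=> //; exists i => //; lia.
have [n [K [cK sK]]] := small_chains dxy.
have n2 := small_linear_chain_size (lexx _) cK sK.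
have [e1 e10 Ke1] := step _ _ cK n2.
have [|m [H [cH sH]]] := @small_chains (Num.min (mdist x y / 2) e1).
  by rewrite lt_min dxy.
have sH' i : (i <= m)%N -> small (mdist x y / 2) (H i).
  by move=> im; apply: small_le (sH _ im); rewrite ge_min lexx.
have m2 := small_linear_chain_size (lexx _) cH sH'.
have [e2 e20 He2] := step _ _ cH m2.
(* The third chain is fine enough relative to both earlier ones. *)
have [|l [G [cG sG]]] := @small_chains (Num.min (mdist x y / 2) (Num.min e1 e2)).
  by rewrite !lt_min dxy e10.
have sG' i : (i <= l)%N -> small (mdist x y / 2) (G i).
  by move=> im; apply: small_le (sG _ im); rewrite ge_min lexx.
have l2 := small_linear_chain_size (lexx _) cG sG'.
apply: (three_mids (lexx _) cK sK cH sH' cG sG').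
- apply: Ke1 => // i im; apply: small_le (sH _ im).
  by rewrite ge_min lexx orbT.
- apply: Ke1 => // i im; apply: small_le (sG _ im).
  by rewrite !ge_min lexx orbT.
- apply: He2 => // i im; apply: small_le (sG _ im).
  by rewrite !ge_min lexx !orbT.
Qed.

(** [P] collects the chains finer than a persistent chain [K] that contain [mid K n]. By fineness
    their end links miss [mid K n], so it lies in the middle part of each. Any two middle parts thus
    share a point [c] of it, which leaves only containment in the dichotomy. *)
Lemma exists_coherent_chains : exists P : nat -> (nat -> set X) -> Prop,
  [/\ forall m H, P m H -> linear_chain x y m H /\ (2 <= m)%N,
      forall e, 0 < e -> exists m H, P m H /\ forall i, (i <= m)%N -> small e (H i),
      forall m H l G, P m H -> P l G -> finer m H l G -> mid H m `<=` links G 0 l &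
      exists c, forall m H, P m H -> mid H m c].
Proof.
have [n [K [cK n2 KP]]] := exists_persistent_chain.
exists (fun m H => [/\ linear_chain x y m H, (2 <= m)%N, finer n K m H &
  mid K n `<=` links H 0 m]).
have midK m H : finer n K m H -> mid K n `<=` links H 0 m -> mid K n `<=` mid H m.
  move=> f KH z Kz; have [i ir Hz] := KH z Kz; exists i => //.
  apply/andP; split.
    rewrite lt0n; apply/eqP => i0; rewrite i0 in Hz.
    by have : set0 z by rewrite -(finer_mid_start f).
  have := andP ir => -[_]; rewrite leq_eqVlt => /orP[/eqP im|]; last by lia.
  by rewrite im in Hz; have : set0 z by rewrite -(finer_mid_end f).
have [[c Kc] _ _] := mid_continuum cK n2.
split.
- by move=> m H [].
- by move=> e /KP[m [H [? ? ? ? ?]]]; exists m, H.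
- move=> m H l G [cH m2 fH KH] [cG l2 fG KG] f.
  apply: mid_sub_links => //; exists c; split; last exact: KG.
  exact: (midK _ _ fH KH).
- by exists c => m H [cH m2 fH KH]; exact: (midK _ _ fH KH).
Qed.

End refinement.

(** * The irreducible continuum *)

Section trace.
Context {T : topologicalType}.
Implicit Types (x y : T) (K : nat -> set T) (I : set T).

Lemma links_rev K n a b : (a <= b <= n)%N ->
  links (fun i => K (n - i)%N) a b = links K (n - b) (n - a).
Proof.
move=> abn; apply/seteqP; split=> z [i ir Kz].
  by exists (n - i)%N => //; lia.
exists (n - i)%N; first by lia.
by rewrite subKn //; lia.
Qed.

(* A clopen piece of the trace of [I] on [K 0] that misses [K 1] would be
   clopen in [I]. *)
Lemma continuum_trace_start x y n K I : hausdorff_space T ->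
  linear_chain x y n K -> (2 <= n)%N -> continuum I ->
  I `<=` links K 0 n -> K 1%N `<=` I -> continuum ((I `&` K 0%N) `|` K 1%N).
Proof.
move=> hT cK n2 cI IK K1I.
have cont_cl A := @hausdorff_continuum_closed T A hT.
have cK0 : continuum (K 0%N) by exact: (chain_continuum cK).
have cK1 : continuum (K 1%N) by apply: (chain_continuum cK); lia.
have [[w0 Kw0] _ conK1] := cK1.
split; first by exists w0; right.
  apply: compactU; last by case: cK1.
  case: (cI) => _ kI _; apply: subclosed_compact kI _; last by move=> z [].
  by apply: closedI; exact: cont_cl.
set W := _ `|` _.
have clW : closed W.
  apply: closedU; last exact: cont_cl.
  by apply: closedI; exact: cont_cl.
(* [G] lies in [K 0], hence misses all links from index 2 on. So [G] and the union of [F] with those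
   links are disjoint closed sets covering [I]; connectedness of [I] empties [G]. *)
have key F G : closed F -> closed G -> F `|` G = W -> F `&` G = set0 ->
    K 1%N `<=` F -> G = set0.
  move=> clF clG FGW FG0 K1F; apply/seteqP; split=> // z Gz.
  have GW : G `<=` I `&` K 0%N.
    move=> u Gu; have : W u by rewrite -FGW; right.
    case=> // /K1F Fu.
    by have : set0 u by rewrite -FG0.
  have disj u : G u -> ~ (F `|` links K 2 n) u.
    move=> Gu [Fu|[i ir Ku]].
      by have : set0 u by rewrite -FG0.
    by apply: (linear_sep cK _ (GW _ Gu).2 Ku); lia.
  have : I `<=` F `|` links K 2 n.
    apply: (@connected_closed_cover _ _ _ G) => //.
    - by case: cI.
    - apply: closedU => //; apply: cont_cl; apply: (links_continuum cK); lia.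
    - move=> u Iu; have [i ir Ku] := IK _ Iu.
      case: i ir Ku => [|[|i]] ir Ku.
      + have : W u by left.
        by rewrite -FGW => -[Fu|Gu]; [left; left|right].
      + by left; left; exact: K1F.
      + by left; right; exists i.+2.
    - by apply/seteqP; split=> u // [[Iu FKu] /disj].
    - by exists w0; split; [exact: K1I|left; exact: K1F].
  by move=> /(_ z (GW _ Gz).1); exact: disj.
move=> B [b Bb] [V oV BV] [C cC BC].
(* [F] is the clopen set [B] and [G] its complement in [W], both closed. The connected set [K 1]
   lies in one of them, and [key] empties the other. *)
pose F := W `&` C; pose G := W `&` ~` V.
have clF : closed F by exact: closedI.
have clG : closed G by apply: closedI => //; exact: open_closedC.
have FE : F = W `&` V by rewrite /F -BC.
have FG : F `|` G = W by rewrite FE /G -setIUr setUv setIT.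
have FG0 : F `&` G = set0.
  by rewrite FE /G setIACA setICr setI0.
have [K1F|K1F] := pselect (K 1%N `&` F !=set0).
  have : K 1%N `<=` F.
    apply: (@connected_closed_cover _ _ _ G) => //.
      by rewrite FG => u; right.
    by rewrite -setIA FG0 setI0.
  move=> /(key F G clF clG FG FG0) G0.
  by rewrite BC -/F -FG G0 setU0.
have : K 1%N `<=` G.
  move=> u Ku; have : W u by right.
  by rewrite -FG => -[Fu|//]; exfalso; apply: K1F; exists u.
move=> /(key G F clG clF) F0; exfalso.
have : set0 b by rewrite -F0; [rewrite /F -BC|rewrite setUC|rewrite setIC].
by [].
Qed.

Lemma continuum_trace_end x y n K I : hausdorff_space T ->
  linear_chain x y n K -> (2 <= n)%N -> continuum I ->
  I `<=` links K 0 n -> K n.-1 `<=` I -> continuum ((I `&` K n) `|` K n.-1).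
Proof.
move=> hT cK n2 cI IK KI.
have := @continuum_trace_start _ _ _ _ I hT (linear_chain_rev cK) n2 cI.
by rewrite (@links_rev K n 0 n) ?leqnn // subnn subn0 subn1; apply.
Qed.

End trace.

Section irreducible.
Context {R : realType} {X : metricType R}.
Implicit Types (A B M : set X) (e : R) (K H G : nat -> set X).
Variables x y : X.
Hypothesis no_triod : forall K : set X, ~ triod K.
Hypothesis xy : x <> y.
Hypothesis small_chains : forall e, 0 < e ->
  exists n K, linear_chain x y n K /\ forall i, (i <= n)%N -> small e (K i).

Lemma exists_irreducible_continuum : exists I : set X,
  [/\ continuum I, I x /\ I y,
    forall M, continuum M -> M `<=` I -> M x -> M y -> I `<=` M &
    forall e, 0 < e -> exists n K, chain x y n K /\
      forall i, (i <= n)%N -> K i `<=` I /\ small e (K i)].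
Proof.
have [P [PL Psmall Pcoh [c Pc]]] := exists_coherent_chains no_triod xy small_chains.
have hX := @metric_hausdorff R X.
pose I := [set z | forall m H, P m H -> links H 0 m z].
have Pcl m H : P m H -> closed (links H 0 m).
  move=> /PL[cH m2]; apply: continuum_closed.
  by apply: (links_continuum cH); lia.
(* Given another chain [K] of [P], take [G] finer than both and as small as desired. The point [z]
   lies in a link of [G], every link of [G] meets the links of [K], and the union of the latter is
   closed. *)
have midI m H : P m H -> mid H m `<=` I.
  move=> PH z Hz n K PK; apply: closed_approx; first exact: Pcl.
  move=> e e0; have [cH m2] := PL _ _ PH; have [cK n2] := PL _ _ PK.
  have [eH eH0 fH] := exists_finer cH (ltnW m2).
  have [eK eK0 fK] := exists_finer cK (ltnW n2).
  have [|l [G [PG sG]]] := Psmall (Num.min e (Num.min eH eK)).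
    by rewrite !lt_min e0 eH0.
  have [cG l2] := PL _ _ PG.
  have fHG : finer m H l G.
    apply: fH => // i il; apply: small_le (sG _ il).
    by rewrite !ge_min lexx orbT.
  have fKG : finer n K l G.
    apply: fK => // i il; apply: small_le (sG _ il).
    by rewrite !ge_min lexx !orbT.
  have [j jl Gz] := Pcoh _ _ _ _ PH PG fHG z Hz.
  have [a [Ga Ka]] := finer_meets_links no_triod cK n2 cG fKG (Pcoh _ _ _ _ PK PG fKG) jl.
  exists a => //; have /(_ j jl) := sG.
  by move=> /small_le -/(_ e); apply => //; rewrite ge_min lexx.
have Ix : I x.
  by move=> m H /PL[cH _]; exists 0%N => //; exact: (chain_start cH).
have Iy : I y.
  by move=> m H /PL[cH _]; exists m; [lia|exact: (chain_end cH)].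
have Icl : closed I.
  rewrite (_ : I = \bigcap_(q in [set q : nat * (nat -> set X) | P q.1 q.2]) links q.2 0 q.1).
    by apply: closed_bigI => -[m H]; exact: Pcl.
  apply/seteqP; split=> z Iz; first by move=> [m H] PH; exact: Iz.
  by move=> m H PH; exact: (Iz (m, H)).
(* This yields connectedness, as all middle parts share [c]. A point of [I] other than [x] and [y]
   avoids the end links of chains finer than its distances from them; [x] and [y] are approached by
   common points of an end link and its neighbour. *)
have IU : I = closure (\bigcup_(q in [set q : nat * (nat -> set X) | P q.1 q.2]) mid q.2 q.1).
  apply/seteqP; split; last first.
    rewrite [X in _ `<=` X](iffLR (closure_id I)) //; apply: closureS => z [[m H] /midI]; exact.
  move=> z Iz; apply: closure_approx => e e0.
  have [zx|zx] := pselect (z = x).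
    have [m [H [PH sH]]] := Psmall _ e0; have [cH m2] := PL _ _ PH.
    have [w [w0 w1]] : H 0%N `&` H 1%N !=set0 by apply: (chain_meet cH); lia.
    exists w; first by exists (m, H) => //; exists 1%N => //=; lia.
    by rewrite zx; apply: (sH 0%N) => //; exact: (chain_start cH).
  have [zy|zy] := pselect (z = y).
    have [m [H [PH sH]]] := Psmall _ e0; have [cH m2] := PL _ _ PH.
    have [w [w0 w1]] : H m.-1 `&` H m.-1.+1 !=set0 by apply: (chain_meet cH); lia.
    exists w; first by exists (m, H) => //; exists m.-1 => //=; lia.
    rewrite zy; apply: (sH m) => //; first exact: (chain_end cH).
    by rewrite prednK in w1 => //; lia.
  have dx : 0 < mdist x z by rewrite mdist_gt0; apply/eqP => h; exact: zx.
  have dy : 0 < mdist y z by rewrite mdist_gt0; apply/eqP => h; exact: zy.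
  have [|m [H [PH sH]]] := Psmall (Num.min (mdist x z) (mdist y z)).
    by rewrite lt_min dx.
  have [cH m2] := PL _ _ PH.
  exists z; last by rewrite mdistxx.
  exists (m, H) => //; have [i ir Hz] := Iz _ _ PH; exists i => //=.
  have i0 : i != 0%N.
    apply/eqP => i0; rewrite i0 in Hz.
    have := sH 0%N isT _ _ (chain_start cH) Hz.
    by rewrite lt_min ltxx.
  have im : i != m.
    apply/eqP => im; rewrite im in Hz.
    have := sH m (leqnn m) _ _ (chain_end cH) Hz.
    by rewrite lt_min ltxx andbF.
  by lia.
have cI : continuum I.
  split; first by exists x.
    have [m [H [PH _]]] := Psmall 1 ltr01; have [cH m2] := PL _ _ PH.
    apply: (@subclosed_compact _ _ (links H 0 m)) => //; last by move=> z /(_ _ _ PH).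
    by have [] : continuum (links H 0 m) by apply: (links_continuum cH); lia.
  rewrite IU; apply: connected_closure; apply: bigcup_connected.
    by exists c => -[m H]; exact: Pc.
  by move=> [m H] /PL[cH m2]; case: (mid_continuum cH m2).
exists I; split=> //.
  (* Irreducibility: [M] meets every link of every chain in [P], since a missed link would separate
     the part of [M] at [x] from the part at [y]. Hence every point of [I] is arbitrarily close to
     [M]. *)
  move=> M cM MI Mx My z Iz; apply: closed_approx; first exact: continuum_closed.
  move=> e e0; have [m [H [PH sH]]] := Psmall _ e0; have [cH m2] := PL _ _ PH.
  have [i ir Hz] := Iz _ _ PH.
  suff [a [Ma Ha]] : M `&` H i !=set0 by exists a => //; apply: (sH i) => //; lia.
  apply: contrapT => nM.
  have i0 : i != 0%N.
    by apply/eqP => E; apply: nM; exists x; rewrite E; split=> //; exact: (chain_start cH).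
  have im : i != m.
    by apply/eqP => E; apply: nM; exists y; rewrite E; split=> //; exact: (chain_end cH).
  have : M `<=` links H 0 i.-1.
    apply: (@connected_closed_cover _ _ _ (links H i.+1 m)).
    - by case: cM.
    - by apply: continuum_closed; apply: (links_continuum cH); lia.
    - by apply: continuum_closed; apply: (links_continuum cH); lia.
    - move=> u Mu; have [j jm Hu] := MI _ Mu _ _ PH.
      have [ji|ij|ji] := ltngtP j i.
      + by left; exists j => //; lia.
      + by right; exists j => //; lia.
      + by exfalso; apply: nM; exists u; rewrite -ji.
    - apply/seteqP; split=> // u [[Mu [j jr Hj]] [k kr Hk]].
      by apply: (linear_sep cH _ Hj Hk); lia.
    - by exists x; split=> //; exists 0%N => //; exact: (chain_start cH).
  by move=> /(_ y My) [j jr Hy]; apply: (linear_end cH _ Hy); lia.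
move=> e e0.
(* Half of [e], because each new end link lies in the union of two meeting links. *)
have [|m [H [PH sH]]] := Psmall (e / 2); first by rewrite divr_gt0.
have [cH m2] := PL _ _ PH.
have HI i : (0 < i < m)%N -> H i `<=` I.
  by move=> im; apply: subset_trans (midI _ _ PH) => z Hz; exists i => //; lia.
have IH : I `<=` links H 0 m by move=> z; exact.
have cE : continuum ((I `&` H 0%N) `|` H 1%N).
  by apply: (continuum_trace_start hX cH) => //; apply: HI; lia.
have cF : continuum ((I `&` H m) `|` H m.-1).
  by apply: (continuum_trace_end hX cH) => //; apply: HI; lia.
have small2 i j A B : (i <= m)%N -> (j <= m)%N -> H i `&` H j !=set0 ->
    A `<=` H i -> B `<=` H j -> small e (A `|` B).
  move=> im jm [w [wi wj]] Ai Bj.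
  have near u : (A `|` B) u -> mdist u w < e / 2.
    move=> [/Ai Hu|/Bj Hu]; [exact: (sH _ im)|exact: (sH _ jm)].
  move=> a b /near aw /near bw; have := metric_triangle a w b.
  rewrite (metric_sym w b); lra.
(* Only the end links of [H] may leave [I]. They are replaced by their traces on [I], joined to the
   neighbouring link to be connected. *)
pose K i := if i == 0%N then (I `&` H 0%N) `|` H 1%N
  else if i == m then (I `&` H m) `|` H m.-1 else H i.
have mK : (m == 0)%N = false by lia.
have KE i : (0 < i < m)%N -> K i = H i.
  move=> im; rewrite /K; have -> : (i == 0)%N = false by lia.
  by have -> : (i == m)%N = false by lia.
exists m, K; split; last first.
  move=> i im; rewrite /K; case: eqP => [i0|i0].
    split; first by move=> z [[]//|]; apply: HI; lia.
    apply: (small2 0%N 1%N) => //; first by lia.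
    by apply: (chain_meet cH); lia.
  case: eqP => [im'|im'].
    split; first by move=> z [[]//|]; apply: HI; lia.
    apply: (small2 m m.-1) => //; first by lia.
    by rewrite setIC -{2}(ltn_predK m2); apply: (chain_meet cH); lia.
  split; first by apply: HI; lia.
  by apply: small_le (sH _ im); lra.
split.
- move=> i im; rewrite /K; case: eqP => // i0; case: eqP => // _.
  exact: (chain_continuum cH).
- by left; split=> //; exact: (chain_start cH).
- by rewrite /K mK eqxx; left; split=> //; exact: (chain_end cH).
- move=> i im.
  have [w [wi wi1]] := chain_meet cH im.
  have [i0|i0] := eqVneq i 0%N.
    rewrite i0 (KE 1%N); last by lia.
    have [[u Hu] _ _] : continuum (H 1%N) by apply: (chain_continuum cH); lia.
    by exists u; split=> //; right.
  have [im'|im'] := eqVneq i.+1 m.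
    rewrite im' (KE i); last by lia.
    have [[u Hu] _ _] : continuum (H i) by apply: (chain_continuum cH); lia.
    exists u; split=> //; rewrite /K mK eqxx; right.
    by rewrite -im'.
  by rewrite !KE; [exists w|lia|lia].
Qed.

End irreducible.

(** * Arcs *)

(** The image is a compact interval, nondegenerate because [x] and [y] have different images.
    Rescaling it to the unit interval gives a continuous bijection [g]. *)
Lemma is_arc_of_injection (R : realType) (T : topologicalType) (I : set T)
    (h : T -> R) (x y : T) : hausdorff_space T -> continuum I ->
  {within I, continuous h} -> {in I &, injective h} -> I x -> I y -> x <> y ->
  is_arc R I.
Proof.
move=> hT [I0 kI cI] ch hinj Ix Iy xy.
have [c1 /set_mem Ic1 max1] := compact_EVT_max I0 kI ch.
have [c0 /set_mem Ic0 min0] := compact_EVT_min I0 kI ch.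
have hI : h @` I = `[h c0, h c1]%classic.
  apply/seteqP; split=> r.
    by move=> [p Ip <-]; rewrite /= in_itv /= min0 ?max1 ?inE.
  rewrite /= in_itv => rI.
  have /connected_intervalP itvI := connected_continuous_connected cI ch.
  by apply: itvI rI; [exists c0|exists c1].
have ab : h c0 < h c1.
  rewrite lt_neqAle min0 ?inE // andbT; apply/eqP => E; apply: xy.
  have hc p : I p -> h p = h c0.
    by move=> Ip; apply/eqP; rewrite eq_le min0 ?inE // andbT E max1 ?inE.
  by apply: hinj; rewrite ?inE // !hc.
have ab0 : 0 < h c1 - h c0 by rewrite subr_gt0.
pose g p := (h p - h c0) / (h c1 - h c0).
have cg : {within I, continuous g}.
  move=> p; apply: cvgM; last exact: cvg_cst.
  by apply: cvgB; [exact: ch|exact: cvg_cst].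
have g01 p : I p -> `[0, 1]%classic (g p).
  move=> Ip; rewrite /= in_itv /= /g divr_ge0 ?subr_ge0 ?(ltW ab) ?min0 ?inE //=.
  by rewrite ler_pdivrMr // mul1r lerB // max1 // inE.
have ginj p q : I p -> I q -> g p = g q -> p = q.
  move=> Ip Iq E; apply: hinj; rewrite ?inE //.
  move: E; rewrite /g => /(mulIf (invr_neq0 (lt0r_neq0 ab0))) E; lra.
have gsurj t : `[0, 1]%classic t -> exists p, I p /\ g p = t.
  rewrite /= in_itv /= => /andP[t0 t1].
  have : (h @` I) (h c0 + t * (h c1 - h c0)).
    rewrite hI /= in_itv /= lerDl mulr_ge0 ?(ltW ab0) //=.
    have : t * (h c1 - h c0) <= h c1 - h c0 by rewrite ger_pMl.
    lra.
  move=> [p Ip hp]; exists p; split=> //; rewrite /g hp addrC addKr mulfK //.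
  exact: lt0r_neq0.
(* The inverse of [g], with the default value [x] outside the unit interval. *)
pose f t := xget x [set p | I p /\ g p = t].
have fP t : `[0, 1]%classic t -> I (f t) /\ g (f t) = t.
  by move=> /gsurj[p Ip]; rewrite /f; case: xgetP => [q ->//|/(_ p)].
exists f, g; split.
(* The preimage under [f] of a closed set [C] is the image under [g] of the compact trace of [C] on
   [I], hence closed. *)
- split=> //; apply/continuous_closedP => C cC; apply/closed_subspaceP.
  exists (g @` (I `&` C)).
    apply: compact_closed; first exact: Rhausdorff.
    apply: continuous_compact.
      by apply: continuous_subspaceW cg => z [].
    exact: compact_closedI.
  apply/seteqP; split=> t [].
    move=> [p [Ip Cp] <-] t01; split=> //; have [If E] := fP _ t01.
    by rewrite -(ginj _ _ If Ip E) in Cp.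
  by move=> Cft t01; split=> //; have [If E] := fP _ t01; exists (f t).
- by move=> t /fP[].
- exact: g01.
- by move=> t /set_mem /fP[].
- by move=> p /set_mem Ip; have [If] := fP _ (g01 _ Ip); exact: ginj.
Qed.

(** Heine's theorem through near-covering compactness: each [u] yields a condition valid for all
    points near [u] and all small [d > 0], and compactness makes one [d] work everywhere. *)
Lemma uniformly_continuous_segment (R : realType) (X : metricType R)
    (f : R -> X) (a b e : R) : {within `[a, b], continuous f} -> 0 < e ->
  exists2 d, 0 < d & forall u v, u \in `[a, b] -> v \in `[a, b] ->
    `|u - v| < d -> mdist (f u) (f v) < e.
Proof.
move=> cf e0.
have /compact_near_coveringP/near_covering_withinP := @segment_compact R a b.
move=> /(_ _ (0^'+) (fun d u => forall v, `[a, b]%classic v ->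
  `|u - v| < d -> mdist (f u) (f v) < e) _) near_e.
have : \forall d \near 0^'+, `[a, b]%classic `<=` (fun u => forall v,
    `[a, b]%classic v -> `|u - v| < d -> mdist (f u) (f v) < e).
  apply: near_e => u uab.
  have /subspace_continuousP/(_ u uab) cfu := cf.
  have := cfu _ (nbhsx_ballx (f u) (e / 2) _).
  rewrite divr_gt0 // => /(_ isT); rewrite /= nbhs_simpl /= => /nbhs_ballP[r r0 ur].
  have r20 : 0 < r / 2 by rewrite divr_gt0.
  exists (ball u (r / 2), `]0, (r / 2)[%classic).
    split; first exact: nbhsx_ballx.
    near=> d; rewrite /= in_itv /=; apply/andP; split; first by [].
    by near: d; exact: nbhs_right_lt.
  move=> [u' d] [/= uu' dr] u'ab v vab u'v.
  have fu w : `[a, b]%classic w -> `|u - w| < r -> mdist (f u) (f w) < e / 2.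
    by move=> wab uw; have := ur w uw wab; rewrite ballEmdist.
  move: uu' dr; rewrite /ball /= in_itv /= => uu' /andP[d0 dr].
  have h1 : mdist (f u) (f u') < e / 2 by apply: fu => //; lra.
  have h2 : mdist (f u) (f v) < e / 2.
    by apply: fu => //; have := ler_distD u' u v; lra.
  have := metric_triangle (f u') (f u) (f v).
  rewrite (metric_sym (f u') (f u)); lra.
move=> /nbhs_ballP[r /= r0 rd]; exists (r / 2); first by rewrite divr_gt0.
move=> u v uab vab uv; apply: (rd (r / 2)) => //=.
- by rewrite /ball /= sub0r normrN gtr0_norm ?divr_gt0 //; lra.
- by rewrite divr_gt0.
Unshelve. all: by end_near. Qed.

(** The parameter interval between [x] and [y] is cut into [n] pieces so short that uniform
    continuity makes their images small. *)
Lemma arc_chain_connected (R : realType) (X : metricType R) (x y : X) :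
  arc_connected R x y -> chain_continuum_connected x y.
Proof.
move=> [<- e e0|].
  exists 0%N, (fun=> [set x]); split=> // i _; split.
    split; [by exists x|exact: compact_set1|exact: connected1].
  apply: (@diam_small _ _ (e / 2)); first by lra.
  by move=> _ _ -> ->; rewrite mdistxx divr_gt0.
move=> [A [[f [g [[cf cg] fA gA fg gf]]] Ax Ay]] e e0.
have [|d d0 fd] := @uniformly_continuous_segment R X f 0 1 (e / 2) cf.
  by rewrite divr_gt0.
have gf' p : A p -> f (g p) = p by move=> Ap; apply: gf; rewrite inE.
have := gA _ Ax; have := gA _ Ay; rewrite /= !in_itv /=.
set s := g x; set t := g y => /andP[t0 t1] /andP[s0 s1].
have [n [n_gt0 nd]] : exists n, (0 < n)%N /\ d^-1 < n%:R.
  by exists (Num.truncn d^-1).+1; split=> //; exact: truncnS_gt.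
have n0 : (0 : R) < n%:R by rewrite ltr0n.
have nd' : n%:R^-1 < d by rewrite invf_plt ?posrE.
pose p (i : nat) : R := s + (t - s) * (i%:R / n%:R).
have p01 i : (i <= n)%N -> 0 <= p i <= 1.
  move=> im; have : 0 <= (i%:R / n%:R : R) <= 1.
    by rewrite divr_ge0 // ler_pdivrMr // mul1r ler_nat.
  rewrite /p; move: (i%:R / n%:R) => c /andP[c0 c1]; apply/andP; split; nra.
have pS i : `|p i - p i.+1| <= n%:R^-1.
  have -> : p i - p i.+1 = - ((t - s) * n%:R^-1).
    by rewrite /p -natr1; field; exact: lt0r_neq0.
  rewrite normrN normrM (gtr0_norm (x := n%:R^-1)) ?invr_gt0 //.
  by apply: ler_piMl; [rewrite invr_ge0 ltW | rewrite ler_norml; apply/andP; split; lra].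
(* Minimum and maximum cover both orders of the parameters [s] and [t]. The [n] pieces have indices
   up to [n.-1]. *)
pose K i := f @` `[Num.min (p i) (p i.+1), Num.max (p i) (p i.+1)].
have sub i : (i < n)%N -> `[Num.min (p i) (p i.+1), Num.max (p i) (p i.+1)] `<=` `[0, 1].
  move=> im u; rewrite /= !in_itv /= ge_min le_max.
  have /andP[a0 a1] := p01 _ (ltnW im); have /andP[b0 b1] := p01 _ im.
  by move=> /andP[/orP[] ? /orP[] ?]; apply/andP; split; lra.
exists n.-1, K; split.
- move=> i im; have {}im : (i < n)%N by lia.
  have cK : {within `[Num.min (p i) (p i.+1), Num.max (p i) (p i.+1)], continuous f}.
    exact: continuous_subspaceW (sub i im) cf.
  split; first split.
  + by exists (f (p i)); exists (p i) => //=; rewrite in_itv /= ge_min le_max !lexx.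
  + by apply: continuous_compact => //; exact: segment_compact.
  + by apply: connected_continuous_connected => //; exact: segment_connected.
  + apply: (@diam_small _ _ (e / 2)); first by lra.
    move=> _ _ [u uK <-] [v vK <-]; apply: fd.
    * exact: sub uK.
    * exact: sub vK.
    * move: uK vK (pS i); rewrite /= !in_itv /= !ge_min !le_max.
      rewrite ler_norml ltr_norml => /andP[/orP[] u1 /orP[] u2]
        /andP[/orP[] v1 /orP[] v2] /andP[pa pb]; apply/andP; split; lra.
- exists (p 0%N); first by rewrite /= in_itv /= ge_min le_max !lexx.
  by rewrite /p mul0r mulr0 addr0 gf'.
- exists (p n); first by rewrite (prednK n_gt0) /= in_itv /= ge_min le_max !lexx !orbT.
  by rewrite /p divff ?gt_eqF // mulr1 addrC subrK gf'.
- move=> i im; exists (f (p i.+1)).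
  by split; exists (p i.+1) => //=; rewrite in_itv /= ge_min le_max !lexx ?orbT.
Qed.

(** * Distance from a point to a set *)

Section set_distance.
Context {R : realType} {X : metricType R}.
Implicit Types (d : X) (A B J : set X) (e : R).

Definition set_dist d A : R := inf [set mdist d a | a in A].

Lemma set_dist_le d A a : A a -> set_dist d A <= mdist d a.
Proof.
move=> Aa; apply: ge_inf; last by exists a.
by exists 0 => _ [b _ <-]; exact: mdist_ge0.
Qed.

Lemma le_set_dist d A r : A !=set0 -> (forall a, A a -> r <= mdist d a) ->
  r <= set_dist d A.
Proof.
move=> [a Aa] rA; apply: lb_le_inf; first by exists (mdist d a), a.
by move=> _ [b Ab <-]; exact: rA.
Qed.

(** A point of [B] outside [A] is within [e] of the point [p] of [A]. *)
Lemma set_dist_leD d A B J e p : A p -> J p -> small e J -> B !=set0 ->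
  B `<=` A `|` J -> set_dist d A <= set_dist d B + e.
Proof.
move=> Ap Jp sJ B0 BAJ; rewrite -lerBlDr; apply: le_set_dist => // b /BAJ[Ab|Jb].
  have e0 : 0 < e by rewrite -(mdistxx p); exact: sJ.
  have := set_dist_le d Ab; lra.
have := set_dist_le d Ap; have := metric_triangle d b p.
have := sJ _ _ Jb Jp; lra.
Qed.

End set_distance.

(** * Coding a bounded sequence by one real number *)

Section weighted_series.
Context {R : realType}.
Implicit Types u v : nat -> R.

(** On sequences in the unit interval this is strictly monotone in each coordinate and Lipschitz for
    the uniform distance, as the next lemmas show. *)
Definition wsum u : R := limn (series (fun m => u m * 2^-1 ^+ m)).

Lemma wsum_cvg u : (forall m, 0 <= u m <= 1) ->
  cvgn (series (fun m => u m * 2^-1 ^+ m)).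
Proof.
move=> u01; apply: (@series_le_cvg _ _ (geometric 1 2^-1)) => [m|m|m|].
- by have /andP[? _] := u01 m; rewrite mulr_ge0 // exprn_ge0.
- by rewrite /= mul1r exprn_ge0.
- by have /andP[_ ?] := u01 m; rewrite /= ler_wpM2r // exprn_ge0.
- by apply: is_cvg_geometric_series; rewrite gtr0_norm // invf_lt1 // ltr1n.
Qed.

(** The weights add up to 2. *)
Lemma wsum_leD u v e : (forall m, 0 <= u m <= 1) -> (forall m, 0 <= v m <= 1) ->
  (forall m, u m <= v m + e) -> wsum u <= wsum v + e *+ 2.
Proof.
move=> u01 v01 uve.
have half1 : `|2^-1 : R| < 1 by rewrite gtr0_norm // invf_lt1 // ltr1n.
have cg := @is_cvg_geometric_series R e 2^-1 half1.
have -> : e *+ 2 = limn (series (geometric e 2^-1)).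
  have cg2 := @cvg_geometric_series R e 2^-1 half1.
  rewrite (cvg_lim (@Rhausdorff R) cg2).
  by field.
rewrite /wsum -limD //; last exact: wsum_cvg.
rewrite -seriesD; apply: lim_series_le; first exact: wsum_cvg.
  by rewrite seriesD; apply: is_cvgD => //; exact: wsum_cvg.
move=> m; rewrite [X in _ <= X](_ : _ = (v m + e) * 2^-1 ^+ m); last first.
  by rewrite mulrDl.
by rewrite ler_wpM2r // exprn_ge0.
Qed.

(** The series of differences has nondecreasing partial sums, and the one of length [k.+1] is
    already positive. *)
Lemma wsum_lt u v k : (forall m, 0 <= u m <= 1) -> (forall m, 0 <= v m <= 1) ->
  (forall m, u m <= v m) -> u k < v k -> wsum u < wsum v.
Proof.
move=> u01 v01 uv uvk.
rewrite -subr_gt0 /wsum -limB; [|exact: wsum_cvg..].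
rewrite -seriesN -seriesD.
have cw : cvgn (series ((fun m => v m * 2^-1 ^+ m) - (fun m => u m * 2^-1 ^+ m))).
  by rewrite seriesD seriesN; apply: is_cvgB; exact: wsum_cvg.
have w0 m : 0 <= ((fun m => v m * 2^-1 ^+ m) - (fun m => u m * 2^-1 ^+ m)) m.
  rewrite [X in _ <= X](_ : _ = (v m - u m) * 2^-1 ^+ m); last by rewrite mulrBl.
  by rewrite mulr_ge0 ?subr_ge0 // exprn_ge0.
have nd : nondecreasing_seq (series ((fun m => v m * 2^-1 ^+ m) - (fun m => u m * 2^-1 ^+ m))).
  by apply/nondecreasing_seqP => m; rewrite seriesSr lerDl.
apply: lt_le_trans (nondecreasing_cvgn_le nd cw k.+1).
rewrite seriesSr; apply: ltr_wpDl; first by rewrite /series /=; exact: sumr_ge0.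
rewrite [X in _ < X](_ : _ = (v k - u k) * 2^-1 ^+ k); last by rewrite mulrBl.
by rewrite mulr_gt0 ?subr_gt0 // exprn_gt0.
Qed.

End weighted_series.

(** * The order on an irreducible continuum, and its embedding in the line *)

Section order.
Context {R : realType} {X : metricType R}.
Implicit Types (M : set X) (e : R) (K : nat -> set X) (p q z : X).
Variables (x y : X) (I : set X).
Hypotheses (cI : continuum I) (Ix : I x) (Iy : I y) (xy : x <> y).
Hypothesis irrI : forall M, continuum M -> M `<=` I -> M x -> M y -> I `<=` M.
Hypothesis chainsI : forall e, 0 < e -> exists n K, linear_chain x y n K /\
  forall i, (i <= n)%N -> K i `<=` I /\ small e (K i).

(** On an arc starting at [x], these are the initial segments. *)
Definition initial M : Prop := [/\ continuum M, M `<=` I & M x].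

Lemma links_cover n K : linear_chain x y n K ->
  (forall i, (i <= n)%N -> K i `<=` I) -> I `<=` links K 0 n.
Proof.
move=> cK KI; apply: irrI.
- by apply: (links_continuum cK); lia.
- by move=> z [i ir Kz]; exact: KI Kz.
- by exists 0%N => //; exact: (chain_start cK).
- by exists n; [lia|exact: (chain_end cK)].
Qed.

Lemma initial_links n K i : linear_chain x y n K ->
  (forall i, (i <= n)%N -> K i `<=` I) -> (i <= n)%N -> initial (links K 0 i).
Proof.
move=> cK KI ni; split.
- by apply: (links_continuum cK); lia.
- by move=> z [j jr Kz]; apply: KI Kz; lia.
- by exists 0%N => //; exact: (chain_start cK).
Qed.

(** By irreducibility [M] and the links from [i] on cover [I]. A point of [N] outside [M] is thus in
    a link of index at most [i] and in one of index at least [i]; linearity puts it in [K i], which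
    is small and meets [M]. *)
Lemma initial_near M N n K e i : initial M -> linear_chain x y n K ->
  (forall i, (i <= n)%N -> K i `<=` I /\ small e (K i)) -> (i <= n)%N ->
  M `&` K i !=set0 -> N `<=` links K 0 i -> 0 < e ->
  forall z, N z -> exists2 a, M a & mdist z a < e.
Proof.
move=> [cM MI Mx] cK sK ni [a [Ma Ka]] NK e0 z Nz.
have IM : I `<=` M `|` links K i n.
  apply: irrI.
  - apply: continuumU => //; first by apply: (links_continuum cK); lia.
    by exists a; split=> //; exists i => //; lia.
  - by move=> u [/MI //|[j jr Ku]]; apply: (sK j _).1 Ku; lia.
  - by left.
  - by right; exists n; [lia|exact: (chain_end cK)].
have [j jr Kz] := NK _ Nz.
have Iz : I z by apply: (sK j _).1 Kz; lia.
have [Mz|[k kr Kz']] := IM _ Iz; first by exists z => //; rewrite mdistxx.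
exists a => //; apply: (sK i ni).2 => //.
have [ij|ij] := eqVneq i j; first by rewrite ij.
have [ik|ik] := eqVneq i k; first by rewrite ik.
by exfalso; apply: (linear_sep cK _ Kz Kz'); lia.
Qed.

(** Let [z] in [M] have distance at least [r] from [N]. In a chain finer than [r] and [e], compare
    the last links met by [M] and [N]. If that of [M] came no later, [z] would be within [r] of [N];
    so it comes later, and every point of [N] is within [e] of [M]. *)
Lemma initial_total M N : initial M -> initial N -> M `<=` N \/ N `<=` M.
Proof.
move=> iM iN; have [|/existsNP[z /not_implyP[Mz nNz]]] := pselect (M `<=` N).
  by left.
right; have [cM MI Mx] := iM; have [cN NI Nx] := iN.
have [r r0 rN] := closed_ball_disjoint (continuum_closed cN) nNz.
move=> w Nw; apply: closed_approx; first exact: continuum_closed.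
move=> e e0.
have [|n [K [cK sK]]] := @chainsI (Num.min e r); first by rewrite lt_min e0.
have IK := links_cover cK (fun i ni => (sK i ni).1).
have top L : initial L -> exists i, [/\ (i <= n)%N, L `&` K i !=set0 & L `<=` links K 0 i].
  move=> [cL LI Lx].
  pose P i := (i <= n)%N && `[< L `&` K i !=set0 >].
  have P0 : P 0%N by apply/asboolP; exists x; split=> //; exact: (chain_start cK).
  have Pn i : P i -> (i <= n)%N by case/andP.
  case: (ex_maxnP (ex_intro (fun i => is_true (P i)) 0%N P0) Pn) => h /andP[hn /asboolP Lh] maxh.
  exists h; split=> // u Lu; have [i ir Ku] := IK _ (LI _ Lu); exists i => //=.
  by apply: maxh; apply/andP; split=> //; apply/asboolP; exists u.
have [i [ni Mi MK]] := top _ iM.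
have [j [nj Nj NK]] := top _ iN.
have mer : 0 < Num.min e r by rewrite lt_min e0.
have [ij|ji] := leqP i j.
  have MK' : M `<=` links K 0 j by move=> u /MK[k kr Ku]; exists k => //; lia.
  have [a Na] := initial_near iN cK sK nj Nj MK' mer Mz.
  by rewrite lt_min => /andP[_]; rewrite ltNge rN.
have NK' : N `<=` links K 0 i by move=> u /NK[k kr Ku]; exists k => //; lia.
have [a Ma ae] := initial_near iM cK sK ni Mi NK' mer Nw.
by exists a => //; move: ae; rewrite lt_min => /andP[].
Qed.

(* Once [I] is known to be an arc, this is its subarc from [x] to [p]. *)
Definition below p : set X := [set z | forall M, initial M -> M p -> M z].

Lemma below_refl p : below p p. Proof. by move=> M. Qed.

(** An initial continuum containing [q] is not inside [M], so it contains [M] and with it [p]. The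
    distance is positive because [below p] lies in the closed set [M]. *)
Lemma below_strict M p q : initial M -> M p -> ~ M q ->
  below p `<=` below q /\ exists2 e, 0 < e & forall a, below p a -> e <= mdist q a.
Proof.
move=> iM Mp nMq; split.
  move=> z pz N iN Nq; have [MN|NM] := initial_total iM iN.
    by apply: MN; exact: pz.
  by exfalso; apply: nMq; exact: NM.
have [cM _ _] := iM.
have [e e0 eM] := closed_ball_disjoint (continuum_closed cM) nMq.
by exists e => // a pa; apply: eM; exact: pa.
Qed.

(** In a chain of links smaller than half the distance of [p] and [q], take the links up to one that
    contains the earlier point. If these contained the later point too, linearity would put both
    points in one link. *)
Lemma initial_separates p q : I p -> I q -> p <> q ->
  exists M, initial M /\ ((M p /\ ~ M q) \/ (M q /\ ~ M p)).
Proof.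
move=> Ip Iq pq.
have d0 : 0 < mdist p q / 2 by rewrite divr_gt0 // mdist_gt0; exact/eqP.
have [n [K [cK sK]]] := chainsI d0.
have KI i : (i <= n)%N -> K i `<=` I by move=> /sK[].
have key r s i j : (i <= j <= n)%N -> K i r -> K j s ->
    mdist p q <= mdist r s -> ~ links K 0 i s.
  move=> ijn Kr Ks rs [k ki Kks].
  have ni : (i <= n)%N by lia.
  suff Kis : K i s by have := (sK i ni).2 _ _ Kr Kis; lra.
  have [kj|kj] := leqP k.+2 j; first by exfalso; apply: (linear_sep cK _ Kks Ks); lia.
  have [<- //|ij] := eqVneq j i.
  by have <- : k = i by lia.
have [i ir Kp] := links_cover cK KI Ip.
have [j jr Kq] := links_cover cK KI Iq.
have [ij|ji] := leqP i j.
  exists (links K 0 i); split; first by apply: (initial_links cK KI); lia.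
  left; split; first by exists i => //; lia.
  by apply: (key p q i j) => //; lia.
exists (links K 0 j); split; first by apply: (initial_links cK KI); lia.
right; split; first by exists j => //; lia.
by apply: (key q p j i) => //; [lia|rewrite metric_sym].
Qed.

(** Points near [p] avoid the finitely many links not containing [p], so they share a link [J] with
    [p]. Adding [J] to an initial continuum through one of the two points gives one through the
    other. *)
Lemma below_continuous p e : I p -> 0 < e -> exists2 d, 0 < d &
  forall q, I q -> mdist p q < d -> exists J, [/\ small e J, J p, J q,
    below q `<=` below p `|` J & below p `<=` below q `|` J].
Proof.
move=> Ip e0; have [n [K [cK sK]]] := chainsI e0.
have KI i : (i <= n)%N -> K i `<=` I by move=> /sK[].
pose D := [set i | (i <= n)%N /\ ~ K i p].
have Dfin : finite_set D.
  by apply: (@sub_finite_set _ _ `I_n.+1) => [i []|]; last exact: finite_II.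
have clU : closed (\bigcup_(i in D) K i).
  apply: closed_bigcup => // i [ni _]; apply: continuum_closed.
  exact: (chain_continuum cK).
have npU : ~ (\bigcup_(i in D) K i) p by move=> [i []].
have [d d0 dU] := closed_ball_disjoint clU npU.
exists d => // q Iq pq.
have [i /andP[_ ni] Kq] := links_cover cK KI Iq.
have Kp : K i p.
  apply: contrapT => nKp; suff : d <= mdist p q by rewrite leNgt pq.
  by apply: dU; exists i.
have ext r s : K i r -> K i s -> below s `<=` below r `|` K i.
  move=> Kr Ks z sz; have [|nKz] := pselect (K i z); first by right.
  left=> M [cM MI Mx] Mr.
  have iMK : initial (M `|` K i).
    split; [|by move=> u [/MI//|]; exact: KI|by left].
    apply: continuumU => //; first exact: (chain_continuum cK).
    by exists r.
  by have [] := sz _ iMK (or_intror Ks).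
exists (K i); split=> //; first by have [] := sK i ni.
  exact: ext.
exact: ext.
Qed.

(* Distances to a dense sequence make [p |-> below p] real valued, as in the
   construction of a Whitney map. *)
Lemma irreducible_is_arc : separable X -> is_arc R I.
Proof.
move=> [D /countable_injP[f finj] dD].
(* The dense sequence, read off from an injection of [D] into the naturals; indices not attained
   give [x]. *)
pose d m := xget x [set z | D z /\ f z = m].
have dP z : D z -> d (f z) = z.
  move=> Dz; rewrite /d; case: xgetP => [w -> [Dw fw]|/(_ z)]; last by case.
  by apply: finj => //; rewrite inE.
have dense_d q e : 0 < e -> exists m, mdist q (d m) < e.
  move=> e0.
  have [| |z [qz Dz]] := dD (interior (ball q e)).
  - exists q; exact: nbhsx_ballx.
  - exact: open_interior.
  - exists (f z); rewrite dP //.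
    by have := interior_subset qz; rewrite ballEmdist.
(* Truncation at 1 keeps the weighted series convergent. *)
pose u p m := Num.min 1 (set_dist (d m) (below p)).
have u01 p m : 0 <= u p m <= 1.
  rewrite /u ge_min lexx /= le_min ler01 /= andbT.
  by apply: le_set_dist; [exists p; exact: below_refl|move=> *; exact: mdist_ge0].
have u_lt M p q : initial M -> M p -> ~ M q -> wsum (u q) < wsum (u p).
  move=> iM Mp nMq; have [pq [r r0 rp]] := below_strict iM Mp nMq.
  (* A dense point within [s] of [q] is closer than [s] to [below q] but at least [r - s >= s] away
     from [below p]. Since [s] is below 1, truncation preserves the strict inequality. *)
  pose s := Num.min 1 r / 2.
  have s0 : 0 < s by rewrite divr_gt0 // lt_min ltr01.
  have sr : s * 2 <= r by rewrite /s divfK // ge_min lexx orbT.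
  have s1 : s * 2 <= 1 by rewrite /s divfK // ge_min lexx.
  have [m qm] := dense_d q s s0.
  apply: (@wsum_lt _ _ _ m) => //.
    move=> k; rewrite /u le_min ge_min lexx /= ge_min; apply/orP; right.
    apply: le_set_dist; first by exists p; exact: below_refl.
    by move=> a /pq qa; exact: set_dist_le.
  have h1 : set_dist (d m) (below q) < s.
    by apply: le_lt_trans (set_dist_le _ (@below_refl q)) _; rewrite metric_sym.
  have h2 : s <= set_dist (d m) (below p).
    apply: le_set_dist; first by exists p; exact: below_refl.
    move=> a /rp ra; have := metric_triangle q (d m) a; lra.
  rewrite /u gt_min; apply/orP; right; rewrite lt_min; apply/andP; split; lra.
have u_near p q e J : small e J -> J p -> J q ->
    below q `<=` below p `|` J -> wsum (u p) <= wsum (u q) + e *+ 2.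
  move=> sJ Jp Jq qp; apply: wsum_leD => // m.
  have e0 : 0 < e by rewrite -(mdistxx p); exact: sJ.
  have := @set_dist_leD _ _ (d m) _ _ _ _ p (@below_refl p) Jp sJ _ qp.
  move=> /(_ (ex_intro _ q (@below_refl q))) h.
  by rewrite /u /Num.min; case: ifP => ?; case: ifP => ?; lra.
apply: (@is_arc_of_injection _ _ _ (fun p => wsum (u p)) x y) => //.
- exact: metric_hausdorff.
- apply/subspace_continuousP => p Ip; apply/cvgrPdist_le => e e0.
  (* Half of [e] compensates for the total weight 2. *)
  have [|r r0 rp] := @below_continuous p (e / 2) Ip; first by rewrite divr_gt0.
  rewrite near_withinE; apply/nbhs_ballP; exists r => //= q.
  rewrite ballEmdist /= => pq Iq; have [J [sJ Jp Jq qp pq']] := rp _ Iq pq.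
  have := u_near _ _ _ _ sJ Jp Jq qp; have := u_near _ _ _ _ sJ Jq Jp pq'.
  by rewrite /from_subspace /= ler_norml => h1 h2; apply/andP; split; lra.
- move=> p q; rewrite !inE => Ip Iq E; apply: contrapT => pq.
  have [M [iM [[Mp nMq]|[Mq nMp]]]] := initial_separates Ip Iq pq.
    by have := u_lt _ _ _ iM Mp nMq; rewrite E ltxx.
  by have := u_lt _ _ _ iM Mq nMp; rewrite E ltxx.
Qed.

End order.

Theorem corollary44 (R : realType) (X : metricType R)
  (polishX : polish R X)
  (no_triod : forall K : set X, ~ triod K) :
  @chain_continuum_connected R X = @arc_connected R X.
Proof.
apply/funext => x; apply/funext => y; apply/propext; split; last first.
  exact: arc_chain_connected.
move=> xy; have [->|nxy] := pselect (x = y); first by left.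
have linear e : 0 < e -> exists n K, linear_chain x y n K /\
    forall i, (i <= n)%N -> small e (K i).
  move=> /xy[n [K [Ke Kx Ky Kmeet]]].
  apply: (@exists_linear_chain _ (small e) x y n K).
    by split=> // i /Ke[].
  by move=> i /Ke[_]; exact: small_diam.
have [I [cI [Ix Iy] irrI chainsI]] := exists_irreducible_continuum no_triod nxy linear.
right; exists I; split=> //.
apply: (@irreducible_is_arc _ _ x y) => //; last by case: polishX.
(* The chains inside [I] were changed at their ends and need not be linear, so they are shortened
   again. *)
move=> e /chainsI[n [K [cK KI]]].
exact: (@exists_linear_chain _ (fun A => A `<=` I /\ small e A) x y n K).
Qed.
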